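(* Let $\Gamma$ be a finite simplicial graph and let $G_\Gamma$ be the associated right-angled Artin group. Then $\widetilde{B}_0(G_\Gamma)$ is trivial.
   Context: **Right-angled Artin groups.** For a finite simplicial graph $\Gamma$ (finite, no loops or multiple edges) with vertex set $V\Gamma$ and edge set $E\Gamma$, $G_\Gamma=\langle V\Gamma\mid [a_i,a_j]=1\text{ for each edge }(a_i,a_j)\in E\Gamma\rangle$. **The functor $\widetilde{B}_0$.** For a group $G$, the non-abelian exterior square $G\wedge G$ is generated by symbols $g\wedge h$ ($g,h\in G$) subject to $gg'\wedge h=(g'^{\,g^{-1}}\wedge h^{\,g^{-1}})(g\wedge h)$, $g\wedge hh'=(g\wedge h)(g^{\,h^{-1}}\wedge h'^{\,h^{-1}})$, $g\wedge g=1$, where $x^y=y^{-1}xy$. Let $M(G)=\ker(G\wedge G\to[G,G],\ g\wedge h\mapsto[g,h])\cong H_2(G,\mathbb Z)$, with $[g,h]=g^{-1}h^{-1}gh$, and $M_0(G)=\langle x\wedge y: x,y\in G,\ [x,y]=1\rangle$. Then $\widetilde{B}_0(G)=M(G)/M_0(G)$. Equivalently, if $G=F/R$ with $F$ free, $\widetilde{B}_0(G)\cong([F,F]\cap R)/\langle K(F)\cap R\rangle$, where $K(F)$ is the set of commutators of $F$.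
   Formalization: M(G) is taken as the kernel of g∧h ↦ ghg⁻¹h⁻¹ rather than g⁻¹h⁻¹gh: with the stated relations of G∧G the latter is not a well-defined homomorphism (it fails already for a free group of rank 3), while the former has kernel H_2(G,Z). *)

(* Defs.v *)
From HB Require Import structures.
From mathcomp Require Import all_boot.
From mathcomp Require Import boolp.

Set Implicit Arguments.
Unset Strict Implicit.
Unset Printing Implicit Defensive.

Local Open Scope group_scope.
Local Open Scope quotient_scope.

(* A word is a sequence of letters; (x, true) stands for x and (x, false) for
   its formal inverse. *)
Definition word (X : Type) : Type := seq (X * bool).

Section PresentedGroup.
Variables (X : choiceType) (R : word X -> word X -> Prop).

(* The congruence on words generated by free cancellation and by the defining
   relations u = v, for R u v. *)
Inductive word_eq : word X -> word X -> Prop :=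
| word_eq_refl u : word_eq u u
| word_eq_sym u v : word_eq u v -> word_eq v u
| word_eq_trans u v w : word_eq u v -> word_eq v w -> word_eq u w
| word_eq_cat u u' v v' :
    word_eq u u' -> word_eq v v' -> word_eq (u ++ v) (u' ++ v')
| word_eq_cancel x b : word_eq [:: (x, b); (x, ~~ b)] [::]
| word_eq_rel u v : R u v -> word_eq u v.

Definition word_eqb : rel (word X) := fun u v => `[< word_eq u v >].

Lemma word_eqb_refl : reflexive word_eqb.
Proof. by move=> u; apply/asboolP; apply: word_eq_refl. Qed.

Lemma word_eqb_sym : symmetric word_eqb.
Proof. by move=> u v; apply/asboolP/asboolP; apply: word_eq_sym. Qed.

Lemma word_eqb_trans : transitive word_eqb.
Proof.
move=> v u w /asboolP uv /asboolP vw; apply/asboolP.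
exact: word_eq_trans uv vw.
Qed.

Canonical word_equiv :=
  EquivRel word_eqb word_eqb_refl word_eqb_sym word_eqb_trans.

(* The group < X | u = v for all R u v >. *)
Definition presented : Type := {eq_quot word_eqb}.
HB.instance Definition _ := Choice.on presented.
HB.instance Definition _ := EqQuotient.on presented.

Lemma presentedP (u v : word X) :
  reflect (\pi_presented u = \pi_presented v) `[< word_eq u v >].
Proof. exact: eqquotP. Qed.

Definition inv_word (u : word X) : word X :=
  rev [seq (l.1, ~~ l.2) | l <- u].

Lemma inv_word_cat u v : inv_word (u ++ v) = inv_word v ++ inv_word u.
Proof. by rewrite /inv_word map_cat rev_cat. Qed.

Lemma inv_wordK : involutive inv_word.
Proof.
move=> u; rewrite /inv_word map_rev revK -map_comp -[RHS]map_id.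
by apply: eq_map => -[x b] /=; rewrite negbK.
Qed.

Lemma word_eq_invr u : word_eq (u ++ inv_word u) [::].
Proof.
elim: u => [|[x b] u IHu]; first exact: word_eq_refl.
rewrite -cat1s inv_word_cat -catA (catA u).
apply: word_eq_trans (word_eq_cancel x b).
rewrite -[[:: (x, b); (x, ~~ b)]]/([:: (x, b)] ++ ([::] ++ [:: (x, ~~ b)])).
apply: word_eq_cat; first exact: word_eq_refl.
by apply: word_eq_cat => //; exact: word_eq_refl.
Qed.

Lemma word_eq_invl u : word_eq (inv_word u ++ u) [::].
Proof. by rewrite -{2}[u]inv_wordK; apply: word_eq_invr. Qed.

Lemma word_eq_inv u v : word_eq u v -> word_eq (inv_word u) (inv_word v).
Proof.
move=> uv; apply: (@word_eq_trans _ (inv_word u ++ (v ++ inv_word v))).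
  rewrite -{1}[inv_word u]cats0; apply: word_eq_cat; first exact: word_eq_refl.
  by apply: word_eq_sym; apply: word_eq_invr.
rewrite -[X in word_eq _ X]cat0s catA.
apply: word_eq_cat; last exact: word_eq_refl.
apply: word_eq_trans (word_eq_invl u).
by apply: word_eq_cat; [apply: word_eq_refl | apply: word_eq_sym].
Qed.

Definition presented_one : presented := \pi_presented [::].
Definition presented_mul (x y : presented) : presented :=
  \pi_presented (repr x ++ repr y).
Definition presented_inv (x : presented) : presented :=
  \pi_presented (inv_word (repr x)).

Lemma word_eq_repr u : word_eq (repr (\pi_presented u)) u.
Proof. by apply/asboolP/presentedP; rewrite reprK. Qed.

Lemma presented_mulE u v :
  presented_mul (\pi u) (\pi v) = \pi_presented (u ++ v).
Proof.
by apply/presentedP/asboolP; apply: word_eq_cat; apply: word_eq_repr.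
Qed.

Lemma presented_invE u : presented_inv (\pi u) = \pi_presented (inv_word u).
Proof. by apply/presentedP/asboolP/word_eq_inv/word_eq_repr. Qed.

Lemma presented_mulA : associative presented_mul.
Proof.
move=> x y z; rewrite -[x]reprK -[y]reprK -[z]reprK.
by rewrite !presented_mulE catA.
Qed.

Lemma presented_mul1 : left_id presented_one presented_mul.
Proof. by move=> x; rewrite -[x]reprK presented_mulE. Qed.

Lemma presented_mulr1 : right_id presented_one presented_mul.
Proof. by move=> x; rewrite -[x]reprK presented_mulE cats0. Qed.

Lemma presented_mulV : left_inverse presented_one presented_inv presented_mul.
Proof.
move=> x; rewrite -[x]reprK presented_invE presented_mulE.
by apply/presentedP/asboolP/word_eq_invl.
Qed.

Lemma presented_mulrV :
  right_inverse presented_one presented_inv presented_mul.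
Proof.
move=> x; rewrite -[x]reprK presented_invE presented_mulE.
by apply/presentedP/asboolP/word_eq_invr.
Qed.

HB.instance Definition _ := isGroup.Build presented
  presented_mulA presented_mul1 presented_mulr1 presented_mulV presented_mulrV.

Definition pgen (x : X) : presented := \pi_presented [:: (x, true)].

Lemma pi_presented_nil : \pi_presented [::] = 1.
Proof. by []. Qed.

Lemma pi_presented_cat u v :
  \pi_presented (u ++ v) = \pi_presented u * \pi_presented v.
Proof. by rewrite -presented_mulE. Qed.

Lemma pi_presented_inv u : \pi_presented (inv_word u) = (\pi_presented u)^-1.
Proof. by rewrite -presented_invE. Qed.

Lemma presented_rel u v : R u v -> \pi_presented u = \pi_presented v.
Proof. by move=> Ruv; apply/presentedP/asboolP/word_eq_rel. Qed.

Lemma presented_ind (P : presented -> Prop) :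
  P 1 -> (forall x z, P z -> P (pgen x * z)) ->
  (forall x z, P z -> P ((pgen x)^-1 * z)) -> forall z, P z.
Proof.
move=> P1 Pg Pv z; rewrite -[z]reprK.
elim: (repr z) => [|[x b] u IHu] //=.
rewrite -cat1s pi_presented_cat; case: b; first exact: Pg.
by rewrite -[[:: _]]/(inv_word [:: (x, true)]) pi_presented_inv; apply: Pv.
Qed.

Section UniversalProperty.
Variables (H : groupType) (f : X -> H).

Definition eval_word (u : word X) : H :=
  \prod_(l <- u) (if l.2 then f l.1 else (f l.1)^-1).

(* The homomorphism extending f, when f respects the relations R. *)
Definition presented_lift (x : presented) : H := eval_word (repr x).

Hypothesis fR : forall u v, R u v -> eval_word u = eval_word v.

Lemma eval_word_eq u v : word_eq u v -> eval_word u = eval_word v.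
Proof.
elim=> {u v} //.
- by move=> u v w _ -> _ ->.
- move=> u u' v v' _ uu' _ vv'.
  by rewrite /eval_word !big_cat /= -!/(eval_word _) uu' vv'.
- move=> x [] /=; rewrite /eval_word !big_cons big_nil /= mulg1.
    exact: mulgV.
  exact: mulVg.
Qed.

Lemma presented_liftE u : presented_lift (\pi u) = eval_word u.
Proof. exact/eval_word_eq/word_eq_repr. Qed.

Lemma presented_lift_gen x : presented_lift (pgen x) = f x.
Proof. by rewrite presented_liftE /eval_word big_seq1. Qed.

Lemma presented_lift_is_morphism : monoid_morphism presented_lift.
Proof.
split=> [|x y]; first by rewrite presented_liftE /eval_word big_nil.
rewrite -[x]reprK -[y]reprK -pi_presented_cat !presented_liftE.
by rewrite /eval_word big_cat.
Qed.

End UniversalProperty.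

End PresentedGroup.

Section Subgroups.
Variable G : groupType.

Inductive generated (S : G -> Prop) : G -> Prop :=
| generated_in x : S x -> generated S x
| generated1 : generated S 1
| generatedM x y : generated S x -> generated S y -> generated S (x * y)
| generatedV x : generated S x -> generated S x^-1.

Record normal_subgroup := NormalSubgroup {
  nsub_mem :> G -> Prop;
  nsub1 : nsub_mem 1;
  nsubM : forall x y, nsub_mem x -> nsub_mem y -> nsub_mem (x * y);
  nsubV : forall x, nsub_mem x -> nsub_mem x^-1;
  nsubJ : forall x y, nsub_mem x -> nsub_mem (x ^ y)
}.

End Subgroups.

Section QuotientGroup.
Variables (G : groupType) (N : normal_subgroup G).

Definition coset_eqb : rel G := fun x y => `[< N (x^-1 * y) >].

Lemma coset_eqb_refl : reflexive coset_eqb.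
Proof. by move=> x; apply/asboolP; rewrite mulVg; apply: nsub1. Qed.

Lemma coset_eqb_sym : symmetric coset_eqb.
Proof.
by move=> x y; apply/asboolP/asboolP => /nsubV; rewrite invgM invgK.
Qed.

Lemma coset_eqb_trans : transitive coset_eqb.
Proof.
move=> y x z /asboolP xy /asboolP yz; apply/asboolP.
by have := nsubM xy yz; rewrite -mulgA mulVKg.
Qed.

Canonical coset_equiv :=
  EquivRel coset_eqb coset_eqb_refl coset_eqb_sym coset_eqb_trans.

Definition quotient_group : Type := {eq_quot coset_eqb}.
HB.instance Definition _ := Choice.on quotient_group.
HB.instance Definition _ := EqQuotient.on quotient_group.

Lemma quotient_groupP (x y : G) :
  reflect (\pi_quotient_group x = \pi_quotient_group y) `[< N (x^-1 * y) >].
Proof. exact: eqquotP. Qed.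

Definition quot_one : quotient_group := \pi_quotient_group 1.
Definition quot_mul (x y : quotient_group) : quotient_group :=
  \pi_quotient_group (repr x * repr y).
Definition quot_inv (x : quotient_group) : quotient_group :=
  \pi_quotient_group (repr x)^-1.

Lemma coset_repr x : N ((repr (\pi_quotient_group x))^-1 * x).
Proof. by apply/asboolP/quotient_groupP; rewrite reprK. Qed.

Lemma quot_mulE x y : quot_mul (\pi x) (\pi y) = \pi_quotient_group (x * y).
Proof.
apply/quotient_groupP/asboolP.
set x' := repr (\pi x); set y' := repr (\pi y).
have -> : (x' * y')^-1 * (x * y) = (x'^-1 * x) ^ y' * (y'^-1 * y).
  by rewrite invgM /conjg !mulgA mulgK.
by apply: nsubM; [apply: nsubJ|]; apply: coset_repr.
Qed.

Lemma quot_invE x : quot_inv (\pi x) = \pi_quotient_group x^-1.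
Proof.
apply/quotient_groupP/asboolP; set x' := repr (\pi x).
have -> : x'^-1^-1 * x^-1 = ((x'^-1 * x) ^ x'^-1)^-1.
  by rewrite /conjg !invgM !invgK -!mulgA mulgV mulg1.
by apply/nsubV/nsubJ/coset_repr.
Qed.

Lemma quot_mulA : associative quot_mul.
Proof.
move=> x y z; rewrite -[x]reprK -[y]reprK -[z]reprK.
by rewrite !quot_mulE mulgA.
Qed.

Lemma quot_mul1 : left_id quot_one quot_mul.
Proof. by move=> x; rewrite -[x]reprK quot_mulE mul1g. Qed.

Lemma quot_mulr1 : right_id quot_one quot_mul.
Proof. by move=> x; rewrite -[x]reprK quot_mulE mulg1. Qed.

Lemma quot_mulV : left_inverse quot_one quot_inv quot_mul.
Proof. by move=> x; rewrite -[x]reprK quot_invE quot_mulE mulVg. Qed.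

Lemma quot_mulrV : right_inverse quot_one quot_inv quot_mul.
Proof. by move=> x; rewrite -[x]reprK quot_invE quot_mulE mulgV. Qed.

HB.instance Definition _ := isGroup.Build quotient_group
  quot_mulA quot_mul1 quot_mulr1 quot_mulV quot_mulrV.

End QuotientGroup.

Section ExteriorSquare.
Variable G : groupType.

Inductive ext_rel : word (G * G) -> word (G * G) -> Prop :=
| ext_relMl g g' h :
    ext_rel [:: ((g * g', h), true)]
            [:: ((g' ^ g^-1, h ^ g^-1), true); ((g, h), true)]
| ext_relMr g h h' :
    ext_rel [:: ((g, h * h'), true)]
            [:: ((g, h), true); ((g ^ h^-1, h' ^ h^-1), true)]
| ext_rel_diag g : ext_rel [:: ((g, g), true)] [::].

Definition ext_square : Type := presented ext_rel.
HB.instance Definition _ := Group.on ext_square.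

Definition wedge (g h : G) : ext_square := pgen ext_rel (g, h).

Lemma wedgeMl g g' h :
  wedge (g * g') h = wedge (g' ^ g^-1) (h ^ g^-1) * wedge g h.
Proof. by rewrite -pi_presented_cat; apply/presented_rel/ext_relMl. Qed.

Lemma wedgeMr g h h' :
  wedge g (h * h') = wedge g h * wedge (g ^ h^-1) (h' ^ h^-1).
Proof. by rewrite -pi_presented_cat; apply/presented_rel/ext_relMr. Qed.

Lemma wedge_diag g : wedge g g = 1.
Proof. by apply/presented_rel/ext_rel_diag. Qed.

(* The commutator map g /\ h |-> g h g^-1 h^-1.  In terms of
   [~ x, y] = x^-1 y^-1 x y this is [~ g^-1, h^-1]: the relations of ext_rel
   are those satisfied by g h g^-1 h^-1, whereas g /\ h |-> [~ g, h] does not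
   respect them for a general G.  The image is [G, G], so taking G as codomain
   does not change the kernel. *)
Definition ext_comm : ext_square -> G :=
  @presented_lift _ ext_rel G (fun p => [~ p.1^-1, p.2^-1]).

Lemma ext_comm_rel u v : ext_rel u v ->
  eval_word (fun p : G * G => [~ p.1^-1, p.2^-1]) u =
  eval_word (fun p : G * G => [~ p.1^-1, p.2^-1]) v.
Proof.
case=> [g g' h|g h h'|g]; rewrite /eval_word !big_cons !big_nil /= ?mulg1.
- by rewrite /commg /conjg !invgM !invgK !mulgA !(mulgK, mulgVK).
- by rewrite /commg /conjg !invgM !invgK !mulgA !(mulgK, mulgVK).
- exact: commgg.
Qed.

Lemma ext_comm_wedge g h : ext_comm (wedge g h) = [~ g^-1, h^-1].
Proof. exact: (presented_lift_gen ext_comm_rel). Qed.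

HB.instance Definition _ := isUMagmaMorphism.Build ext_square G ext_comm
  (presented_lift_is_morphism ext_comm_rel).

Definition in_schur : pred ext_square := fun x => ext_comm x == 1.

Lemma in_schur_closed : group_closed in_schur.
Proof.
have mE x : (x \in in_schur) = (ext_comm x == 1) by [].
split=> [|x y]; rewrite !mE; first by rewrite gmulf1.
by move=> /eqP x1 /eqP y1; rewrite gmulfF /= x1 y1 divgg.
Qed.

(* M(G), isomorphic to H_2(G, Z) *)
Definition schur : Type := {x : ext_square | in_schur x}.
HB.instance Definition _ := SubChoice.on schur.
HB.instance Definition _ :=
  SubChoice_isSubGroup.Build ext_square in_schur schur in_schur_closed.

(* Membership in M_0(G), which lies in M(G) by in_schur0_sub. *)
Definition in_schur0 : ext_square -> Prop :=
  generated (fun w => exists x y, [~ x, y] = 1 /\ w = wedge x y).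

Lemma in_schur0_sub w : in_schur0 w -> in_schur w.
Proof.
rewrite /in_schur.
elim=> {w} [_ [x [y [xy1 ->]]]||x y _ /eqP x1 _ /eqP y1|x _ /eqP x1].
- rewrite ext_comm_wedge; apply/commgP/commuteV/commute_sym/commuteV.
  by apply/commute_sym/commgP/eqP.
- by rewrite gmulf1.
- by rewrite gmulfM /= x1 y1 mulg1.
- by rewrite gmulfV /= x1 invg1.
Qed.

Lemma wedgeJ a b g h :
  wedge a b * wedge g h =
  wedge (g ^ [~ a^-1, b^-1]^-1) (h ^ [~ a^-1, b^-1]^-1) * wedge a b.
Proof.
have key g' h' : wedge (g' ^ (b^-1 * a^-1)) (h' ^ (b^-1 * a^-1)) * wedge a b =
    wedge a b * wedge (g' ^ (a^-1 * b^-1)) (h' ^ (a^-1 * b^-1)).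
  have cc (x y : G) : y^-1 * (x ^ y^-1)^-1 = x^-1 * y^-1.
    by rewrite /conjg !invgM !invgK !mulgA mulVg mul1g.
  have := wedgeMl a g' (b * h').
  rewrite (wedgeMr (a * g') b h') (wedgeMl a g' b) (wedgeMr a b h').
  rewrite (conjMg b h' a^-1) (conjMg a g' b^-1).
  rewrite (wedgeMr (g' ^ a^-1) (b ^ a^-1) (h' ^ a^-1)).
  rewrite (wedgeMl (a ^ b^-1) (g' ^ b^-1) (h' ^ b^-1)).
  rewrite -!conjgM !cc -!mulgA => /mulgI; rewrite !mulgA => /mulIg.
  by [].
have e (x : G) : (x ^ (b * a)) ^ (a^-1 * b^-1) = x.
  by rewrite -conjgM -[X in _ * X]invgM mulgV conjg1.
rewrite -{1}[g]e -{1}[h]e -key -!conjgM; congr (wedge (_ ^ _) (_ ^ _) * _);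
by rewrite /commg /conjg !invgM !invgK !mulgA.
Qed.

Lemma in_schur0J w z : in_schur0 w -> in_schur0 (w ^ z).
Proof.
have gJ (p : ext_square) : (forall x y, [~ x, y] = 1 ->
    in_schur0 (wedge x y ^ p)) -> forall v, in_schur0 v -> in_schur0 (v ^ p).
  move=> pP v; elim=> {v} [_ [x [y [xy1 ->]]]||x y _ Sx _ Sy|x _ Sx].
  - exact: pP.
  - by rewrite conj1g; apply: generated1.
  - by rewrite conjMg; apply: generatedM.
  - by rewrite conjVg; apply: generatedV.
elim/presented_ind: z w => [w|[a b] z IHz w Sw|[a b] z IHz w Sw].
- by rewrite conjg1.
- rewrite conjgM; apply: IHz; apply: gJ Sw => x y xy1.
  apply: generated_in; exists (x ^ [~ a^-1, b^-1]), (y ^ [~ a^-1, b^-1]).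
  rewrite -conjRg xy1 conj1g; split=> //.
  by apply: (mulgI (wedge a b)); rewrite -conjgC [RHS]wedgeJ !conjgK.
- rewrite conjgM; apply: IHz; apply: gJ Sw => x y xy1.
  apply: generated_in.
  exists (x ^ [~ a^-1, b^-1]^-1), (y ^ [~ a^-1, b^-1]^-1).
  rewrite -conjRg xy1 conj1g; split=> //.
  by apply: (mulIg (wedge a b)); rewrite -conjgCV wedgeJ.
Qed.

Definition schur0_mem (x : schur) : Prop := in_schur0 (val x).

Lemma schur0_1 : schur0_mem 1.
Proof. exact: generated1. Qed.

Lemma schur0M x y : schur0_mem x -> schur0_mem y -> schur0_mem (x * y).
Proof. exact: generatedM. Qed.

Lemma schur0V x : schur0_mem x -> schur0_mem x^-1.
Proof. exact: generatedV. Qed.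

Lemma schur0J x y : schur0_mem x -> schur0_mem (x ^ y).
Proof. exact: in_schur0J. Qed.

Definition schur0 : normal_subgroup schur :=
  NormalSubgroup schur0_1 schur0M schur0V schur0J.

Definition B0 : groupType := quotient_group schur0.

End ExteriorSquare.

Section RightAngledArtinGroup.
Variables (V : finType) (e : rel V).

Inductive raag_rel : word V -> word V -> Prop :=
| raag_rel_edge a b : e a b ->
    raag_rel [:: (a, false); (b, false); (a, true); (b, true)] [::].

Definition raag : groupType := presented raag_rel.

End RightAngledArtinGroup.

(* Main.v *)
Require Import Defs.
From mathcomp Require Import all_boot.
From HB Require Import structures.
From mathcomp Require Import boolp.

(** In homological terms: write the right-angled Artin group [G] as [F/R] with
    [F] free. As [R] is the normal closure of commutators of adjacent vertices,
    [M(G) = ([F,F] /\ R)/[F,R] = R/[F,R]] is generated by the classes of these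
    commutators, that is by elements [a /\ b] with [a] and [b] commuting; hence
    [M(G) = M_0(G)].

    The proof below is a version of this argument that avoids identifying
    [G /\ G] with [[F,F]/[F,R]]. Instead of a free group it uses a group [E]
    containing [G /\ G] and projecting to [G], in which the vertices [a] have
    lifts [t_a] whose commutators are the formal ones:
    [[t_a, t_b] = wcomm a b]. Such an [E] is obtained by adjoining the lifts one
    at a time ([ext_over_lift]): if [E] is given and [a] is any element of [G],
    then [G] acts on [E] by [x |-> x * wcomm (proj x) g], and in the resulting
    semidirect product the element [a] of the factor [G] has the required
    commutators with [E].

    In [E / M_0(G)] the lifts of adjacent vertices commute, so [a |-> t_a]
    defines a homomorphism [s] on [G]. The commutator identities propagate
    [[s g, s h] = wcomm g h] from the vertices to all [g] and [h]
    ([section_comm]), so the class of each [w] in [G /\ G] is [s] applied to the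
    commutator image of [w] ([section_ext_comm]). For [w] in [M(G)] this image
    is [1], so [w] is trivial modulo [M_0(G)]. *)

Set Implicit Arguments.
Unset Strict Implicit.
Unset Printing Implicit Defensive.

Local Open Scope group_scope.
Local Open Scope quotient_scope.

(** * Calculus of formal commutators *)

Section FormalCommutators.
Variable G : groupType.
Implicit Types a b g h k : G.

(** The symbol above the commutator [[~ g, h]]. The inverses translate between
    the convention [g h g^-1 h^-1] that the exterior square follows and the
    convention [g^-1 h^-1 g h] of [[~ g, h]]; in terms of [wcomm] the defining
    relations become the usual identities for right conjugation. *)
Definition wcomm g h : ext_square G := wedge g^-1 h^-1.

Lemma wedge_wcomm g h : wedge g h = wcomm g^-1 h^-1.
Proof. by rewrite /wcomm !invgK. Qed.

Lemma ext_comm_wcomm g h : ext_comm (wcomm g h) = [~ g, h].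
Proof. by rewrite ext_comm_wedge !invgK. Qed.

Lemma wcommMl g h k : wcomm (g * h) k = wcomm (g ^ h) (k ^ h) * wcomm h k.
Proof. by rewrite /wcomm invgM wedgeMl invgK !conjVg. Qed.

Lemma wcommMr g h k : wcomm g (h * k) = wcomm g k * wcomm (g ^ k) (h ^ k).
Proof. by rewrite /wcomm invgM wedgeMr invgK !conjVg. Qed.

Lemma wcomm_diag g : wcomm g g = 1.
Proof. exact: wedge_diag. Qed.

Lemma wcomm1r g : wcomm g 1 = 1.
Proof.
have := wcommMr g 1 1; rewrite mulg1 !conjg1.
by rewrite -{1}[wcomm g 1]mulg1 => /mulgI <-.
Qed.

Lemma wcomm1l g : wcomm 1 g = 1.
Proof.
have := wcommMl 1 1 g; rewrite mulg1 !conjg1.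
by rewrite -{1}[wcomm 1 g]mulg1 => /mulgI <-.
Qed.

(** The other expansion of a product on the right, from
    [h * k = k ^ h^-1 * h]. Comparing it with [wcommMr] is what gives
    [wcommC] and [wcomm_commg], and it makes [twist] an action. *)
Lemma wcommMr_swap g h k : wcomm g (h * k) = wcomm g h * wcomm (g ^ h) k.
Proof.
have -> : h * k = k ^ h^-1 * h by rewrite conjgE invgK mulgA mulgVK.
by rewrite wcommMr conjgKV.
Qed.

Lemma wcommC g h : wcomm g h = (wcomm h g)^-1.
Proof.
apply/divg1_eq; rewrite invgK.
(* Expand [wcomm (u * h) (u * h) = 1], with [u] chosen so that [u ^ h = g]. *)
have := wcomm_diag (g ^ h^-1 * h).
rewrite wcommMl (wcommMr h) wcomm_diag mul1g (conjMg _ h h) conjgKV.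
have conjgg (x : G) : x ^ x = x by rewrite conjgE mulKg.
by rewrite !conjgg wcommMr_swap wcomm_diag mul1g conjgg.
Qed.

Lemma wcommJ g h a b :
  wcomm g h ^ wcomm a b = wcomm (g ^ [~ a, b]) (h ^ [~ a, b]).
Proof.
apply: (mulgI (wcomm a b)); rewrite -conjgC.
by rewrite [RHS]wedgeJ !invgK -!conjVg !conjgK.
Qed.

(** The Peiffer identity of the crossed module [ext_comm]. *)
Lemma ext_square_conj g h (w : ext_square G) :
  wcomm g h ^ w = wcomm (g ^ ext_comm w) (h ^ ext_comm w).
Proof.
elim/presented_ind: w g h => [g h|[a b] w IHw g h|[a b] w IHw g h].
- by rewrite gmulf1 !conjg1.
- rewrite -/(wedge a b) conjgM (wedge_wcomm a b) wcommJ IHw.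
  by rewrite gmulfM /= ext_comm_wcomm !conjgM.
rewrite -/(wedge a b) conjgM (wedge_wcomm a b) gmulfM gmulfV /= ext_comm_wcomm.
rewrite !conjgM -IHw; congr (_ ^ _); apply: (canLR (conjgKV _)).
by rewrite invgK wcommJ !conjgKV.
Qed.

(** Both sides are [(wcomm a g)^-1 * wcomm a (b * g)], by the two expansions of
    [wcomm a (b * g)]. *)
Lemma wcomm_commg a b g :
  wcomm a b * wcomm [~ a, b] g = wcomm (a ^ g) (b ^ g).
Proof.
have Vl : wcomm a^-1 (g ^ a) = (wcomm a g)^-1.
  apply/divg1_eq; rewrite invgK -[in RHS](wcomm1l g) -[in RHS](mulVg a).
  by rewrite wcommMl [a^-1 ^ a]conjgE mulVg mulg1.
have -> : wcomm [~ a, b] g = (wcomm a g)^-1 ^ wcomm a b * wcomm (a ^ b) g.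
  (* Expand [[~ a, b] = a^-1 * a ^ b]; conjugating [wcomm a^-1 (g ^ a)] by
     [[~ a, b]] is conjugating it by [wcomm a b]. *)
  rewrite {1}commgEl wcommMl -Vl wcommJ.
  have -> : a ^ b = a * [~ a, b] by rewrite commgEl mulVKg.
  by rewrite !conjgM [a^-1 ^ a]conjgE mulVg mulg1.
by rewrite mulgA -conjgC -mulgA -wcommMr_swap wcommMr mulKg.
Qed.

End FormalCommutators.

(** * Groups containing the exterior square *)

(** A group containing [G /\ G] as a normal subgroup, with a projection to [G]
    that extends the commutator map and through which it acts on [G /\ G]. The
    kernel of the projection may be large: it grows each time a lift is
    adjoined, while [G /\ G] stays embedded. *)
Record ext_over (G : groupType) := ExtOver {
  over_group :> groupType;
  over_in : UMagmaMorphism.type (ext_square G) over_group;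
  over_proj : UMagmaMorphism.type over_group G;
  over_in_inj : injective over_in;
  over_projK : forall w, over_proj (over_in w) = ext_comm w;
  over_inJ : forall a b x, over_in (wcomm a b) ^ x =
    over_in (wcomm (a ^ over_proj x) (b ^ over_proj x))
}.

Definition ext_over_self (G : groupType) : ext_over G :=
  @ExtOver G (ext_square G) idfun (@ext_comm G) (@inj_id _)
    (fun=> erefl) (@ext_square_conj G).

Section Twist.
Variables (G : groupType) (E : ext_over G).
Local Notation iota := (@over_in G E).
Local Notation proj := (@over_proj G E).
Implicit Types (x y : E) (g h a b : G).

(** The action of [G] on [E] lifting conjugation: [twist x g] is what [x ^ u]
    has to be for a lift [u] of [g] such that [[~ x, u] = wcomm (proj x) g]. *)
Definition twist x g : E := x * iota (wcomm (proj x) g).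

Lemma twistM x y g : twist (x * y) g = twist x g * twist y g.
Proof.
rewrite /twist gmulfM /= wcommMl gmulfM /= -over_inJ.
by rewrite !mulgA; congr (_ * _); rewrite -!mulgA -conjgC.
Qed.

Lemma twist1 x : twist x 1 = x.
Proof. by rewrite /twist wcomm1r gmulf1 mulg1. Qed.

Lemma twist1l g : twist 1 g = 1.
Proof. by rewrite /twist gmulf1 wcomm1l gmulf1 mulg1. Qed.

Lemma proj_twist x g : proj (twist x g) = proj x ^ g.
Proof. by rewrite gmulfM /= over_projK ext_comm_wcomm commgEl mulVKg. Qed.

Lemma twist_twist x g h : twist x (g * h) = twist (twist x g) h.
Proof.
by rewrite {2}/twist proj_twist /twist wcommMr_swap gmulfM /= mulgA.
Qed.

(** On the exterior square the twist is the natural action of [G]. *)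
Lemma twist_in a b g :
  twist (iota (wcomm a b)) g = iota (wcomm (a ^ g) (b ^ g)).
Proof. by rewrite /twist over_projK ext_comm_wcomm -gmulfM wcomm_commg. Qed.

(** The semidirect product of [G] and [E] along [twist]; the pair [(g, x)]
    stands for [g * x], so that [(1, x) ^ (g, 1) = (1, twist x g)]. *)
Definition semidirect : Type := (G * E)%type.
HB.instance Definition _ := Choice.on semidirect.

Definition sd_one : semidirect := (1, 1).
Definition sd_mul (u v : semidirect) : semidirect :=
  (u.1 * v.1, twist u.2 v.1 * v.2).
Definition sd_inv (u : semidirect) : semidirect :=
  (u.1^-1, twist u.2^-1 u.1^-1).

Lemma sd_mulA : associative sd_mul.
Proof.
move=> [g x] [h y] [k z].
by rewrite /sd_mul /= twistM twist_twist !mulgA.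
Qed.

Lemma sd_mul1 : left_id sd_one sd_mul.
Proof. by move=> [g x]; rewrite /sd_mul /= twist1l !mul1g. Qed.

Lemma sd_mulr1 : right_id sd_one sd_mul.
Proof. by move=> [g x]; rewrite /sd_mul /= twist1 !mulg1. Qed.

Lemma sd_mulV : left_inverse sd_one sd_inv sd_mul.
Proof.
by move=> [g x]; rewrite /sd_mul /= -twist_twist mulVg twist1 mulVg.
Qed.

Lemma sd_mulrV : right_inverse sd_one sd_inv sd_mul.
Proof. by move=> [g x]; rewrite /sd_mul /= -twistM !mulgV twist1l. Qed.

HB.instance Definition _ := isGroup.Build semidirect
  sd_mulA sd_mul1 sd_mulr1 sd_mulV sd_mulrV.

Definition sd_in (x : E) : semidirect := (1, x).
Definition sd_proj (u : semidirect) : G := u.1 * proj u.2.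

Lemma sd_in_is_morphism : monoid_morphism sd_in.
Proof.
split=> // x y; rewrite /sd_in [RHS]/(sd_mul _ _) /sd_mul /=.
by rewrite twist1 mulg1.
Qed.
HB.instance Definition _ :=
  isUMagmaMorphism.Build E semidirect sd_in sd_in_is_morphism.

Lemma sd_proj_is_morphism : monoid_morphism sd_proj.
Proof.
split=> [|[g x] [h y]]; first by rewrite /sd_proj /= mul1g gmulf1.
rewrite /sd_proj /= gmulfM /= proj_twist !mulgA; congr (_ * _).
by rewrite -!mulgA -conjgC.
Qed.
HB.instance Definition _ :=
  isUMagmaMorphism.Build semidirect G sd_proj sd_proj_is_morphism.

Lemma sd_in_inj : injective (sd_in \o iota).
Proof. by move=> v w [] /over_in_inj. Qed.

Lemma sd_projK w : sd_proj (sd_in (iota w)) = ext_comm w.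
Proof. by rewrite /sd_proj /= mul1g over_projK. Qed.

Lemma sd_inJ a b (u : semidirect) : sd_in (iota (wcomm a b)) ^ u =
  sd_in (iota (wcomm (a ^ sd_proj u) (b ^ sd_proj u))).
Proof.
apply: (mulgI u); rewrite -conjgC; case: u => g x.
rewrite [LHS]/(sd_mul _ _) [RHS]/(sd_mul _ _) /sd_mul /= mul1g mulg1.
by rewrite twist_in twist1 !conjgM -over_inJ conjgC.
Qed.

Definition ext_over_semidirect : ext_over G :=
  @ExtOver G semidirect (sd_in \o iota) sd_proj sd_in_inj sd_projK sd_inJ.

(** The reason for the construction: [(a, 1)] is a lift of [a] whose
    commutators with [E] are the formal ones. *)
Lemma sd_comm x a : [~ sd_in x, (a, 1) : semidirect] =
  sd_in (iota (wcomm (proj x) a)).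
Proof.
rewrite commgEl; apply: (canLR (mulKg _)).
apply: (mulgI ((a, 1) : semidirect)); rewrite -conjgC -gmulfM /=.
rewrite [LHS]/(sd_mul _ _) [RHS]/(sd_mul _ _) /sd_mul /= twist1l.
by rewrite mul1g !mulg1 mul1g.
Qed.

End Twist.

(** By induction on [s], one semidirect product for each element. A new lift
    has the right commutators with the old ones by [sd_comm], with itself
    because [wcomm g g = 1], and [wcommC] exchanges old and new. *)
Lemma ext_over_lift (G : groupType) (I : eqType) (a : I -> G) (s : seq I) :
  exists (E : ext_over G) (t : I -> E),
    {in s, forall i, over_proj E (t i) = a i} /\
    {in s &, forall i j, [~ t i, t j] = over_in E (wcomm (a i) (a j))}.
Proof.
elim: s => [|k s [E [t [pt ct]]]].
  by exists (ext_over_self G), (fun=> 1); split.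
exists (ext_over_semidirect E),
  (fun i => if i == k then (a k, 1) : semidirect E else sd_in (t i)).
split=> [i|i j].
  rewrite inE; case: eqP => [-> _|_ /= si];
    rewrite [LHS]/(sd_proj _) /sd_proj /=.
    by rewrite gmulf1 mulg1.
  by rewrite mul1g pt.
rewrite !inE; case: (eqVneq i k) => [->|_]; case: (eqVneq j k) => [->|_] //=.
- by move=> _ _; rewrite commgg wcomm_diag !gmulf1.
- by move=> _ sj; rewrite -invgR sd_comm pt // [in RHS]wcommC !gmulfV.
- by move=> si _; rewrite sd_comm pt.
by move=> si sj; rewrite -gmulfR ct.
Qed.

(** * Sections over a presented group *)

Lemma commMgJ (G : groupType) (x y z : G) :
  [~ x * y, z] = [~ x, z] ^ y * [~ y, z].
Proof. by rewrite /commg /conjg !invgM !mulgA !(mulgK, mulgVK). Qed.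

(** Let [s] map a presented group [G] to [Q] and [q] map [G /\ G] to [Q].
    Compatibility of [q] with conjugation and commutators in [Q] propagates from
    the generators of [G] to all of [G], because [wcomm] obeys the same product
    rules as commutators. *)
Section PresentedSection.
Variables (X : choiceType) (R : word X -> word X -> Prop) (Q : groupType).
Variables (s : UMagmaMorphism.type (presented R) Q).
Variables (q : UMagmaMorphism.type (ext_square (presented R)) Q).
Implicit Types (x y : X) (g h k : presented R).

Hypothesis qJ_gen : forall x g h, q (wcomm g h) ^ s (pgen R x) =
  q (wcomm (g ^ pgen R x) (h ^ pgen R x)).
Hypothesis q_gen : forall x y, [~ s (pgen R x), s (pgen R y)] =
  q (wcomm (pgen R x) (pgen R y)).

Lemma section_conj k g h : q (wcomm g h) ^ s k = q (wcomm (g ^ k) (h ^ k)).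
Proof.
elim/presented_ind: k g h => [|x k IHk|x k IHk] g h.
- by rewrite gmulf1 !conjg1.
- by rewrite gmulfM /= !conjgM qJ_gen IHk.
rewrite gmulfM gmulfV /= !conjgM -IHk; congr (_ ^ _).
by apply: (canLR (conjgK _)); rewrite qJ_gen !conjgKV.
Qed.

Lemma section_commM g g' h :
    [~ s g, s h] = q (wcomm g h) -> [~ s g', s h] = q (wcomm g' h) ->
  [~ s (g * g'), s h] = q (wcomm (g * g') h).
Proof.
move=> gh g'h; rewrite gmulfM /= commMgJ gh g'h section_conj.
by rewrite (wcommMl g g') gmulfM.
Qed.

(** [[~ s g, s h]] and [q (wcomm g h)] satisfy the same identity
    [1 = c (g^-1 * g) h = (c g^-1 h) ^ s g * c g h]. *)
Lemma section_commV g h :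
  [~ s g, s h] = q (wcomm g h) -> [~ s g^-1, s h] = q (wcomm g^-1 h).
Proof.
move=> gh; apply: (conjg_inj (s g)); rewrite section_conj.
apply: (mulIg [~ s g, s h]); rewrite -commMgJ -gmulfM mulVg.
by rewrite gmulf1 comm1g gh -gmulfM -(wcommMl g^-1 g h) mulVg wcomm1l gmulf1.
Qed.

Lemma section_comm_genl h :
    (forall x, [~ s (pgen R x), s h] = q (wcomm (pgen R x) h)) ->
  forall g, [~ s g, s h] = q (wcomm g h).
Proof.
move=> qh; elim/presented_ind=> [|x g IHg|x g IHg].
- by rewrite gmulf1 comm1g wcomm1l gmulf1.
- exact: section_commM.
by apply: section_commM => //; apply: section_commV.
Qed.

Lemma section_comm g h : [~ s g, s h] = q (wcomm g h).
Proof.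
apply: section_comm_genl => x; rewrite -invgR wcommC gmulfV; congr _^-1.
by apply: section_comm_genl.
Qed.

Lemma section_ext_comm w : s (ext_comm w) = q w.
Proof.
elim/presented_ind: w => [|[a b] w IHw|[a b] w IHw]; first by rewrite !gmulf1.
  rewrite -/(wedge a b) (wedge_wcomm a b) !gmulfM /= IHw; congr (_ * _).
  by rewrite ext_comm_wcomm gmulfR section_comm.
rewrite -/(wedge a b) (wedge_wcomm a b) !gmulfM /= IHw; congr (_ * _).
by rewrite !gmulfV /= ext_comm_wcomm gmulfR section_comm.
Qed.

End PresentedSection.

Section Quotient.
Variables (G : groupType) (N : normal_subgroup G).

Definition quot_proj (x : G) : quotient_group N := \pi_(quotient_group N) x.

Lemma quot_proj_is_morphism : monoid_morphism quot_proj.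
Proof. by split=> // x y; rewrite /quot_proj -quot_mulE. Qed.
HB.instance Definition _ :=
  isUMagmaMorphism.Build G (quotient_group N) quot_proj quot_proj_is_morphism.

Lemma quot_proj_eq1 x : quot_proj x = 1 <-> N x.
Proof.
split=> [x1|Nx].
  have /quotient_groupP/asboolP : quot_proj 1 = quot_proj x.
    by rewrite x1 gmulf1.
  by rewrite invg1 mul1g.
by apply/esym/quotient_groupP/asboolP; rewrite invg1 mul1g.
Qed.

End Quotient.

(** * Right-angled Artin groups *)

Section CommutingKernel.
Variables (G : groupType) (E : ext_over G).

(** The image of [M_0(G)] in [E]. It is normal because conjugation in [E] moves
    [wcomm a b] to [wcomm] of a conjugate, still commuting, pair. *)
Definition over_schur0 (x : E) : Prop :=
  exists2 w, in_schur0 w & x = over_in E w.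

Lemma over_schur0_1 : over_schur0 1.
Proof. by exists 1; [apply: generated1 | rewrite gmulf1]. Qed.

Lemma over_schur0M x y :
  over_schur0 x -> over_schur0 y -> over_schur0 (x * y).
Proof.
move=> [v Sv ->] [w Sw ->].
by exists (v * w); [apply: generatedM | rewrite gmulfM].
Qed.

Lemma over_schur0V x : over_schur0 x -> over_schur0 x^-1.
Proof.
by move=> [v Sv ->]; exists v^-1; [apply: generatedV | rewrite gmulfV].
Qed.

Lemma over_schur0J x y : over_schur0 x -> over_schur0 (x ^ y).
Proof.
move=> [w Sw ->]; elim: Sw => {w} [w [a [b [ab1 ->]]]||v w _ Sv _ Sw|v _ Sv].
- rewrite wedge_wcomm over_inJ; eexists; last reflexivity.
  apply: generated_in; exists (a ^ over_proj E y), (b ^ over_proj E y).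
  by rewrite -conjRg ab1 conj1g /wcomm -!conjVg !invgK.
- by rewrite gmulf1 conj1g; apply: over_schur0_1.
- by rewrite gmulfM conjMg; apply: over_schur0M.
by rewrite gmulfV conjVg; apply: over_schur0V.
Qed.

Definition over_schur0_normal : normal_subgroup E :=
  NormalSubgroup over_schur0_1 over_schur0M over_schur0V over_schur0J.

End CommutingKernel.

Lemma raag_edge_comm (V : finType) (e : rel V) (a b : V) : e a b ->
  [~ pgen (raag_rel e) a, pgen (raag_rel e) b] = 1.
Proof.
move=> eab; apply: etrans (presented_rel (raag_rel_edge eab)).
rewrite -[[:: _; _; _; _]]/(inv_word [:: (a, true)] ++
  (inv_word [:: (b, true)] ++ ([:: (a, true)] ++ [:: (b, true)]))).
by rewrite !pi_presented_cat !pi_presented_inv.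
Qed.

Lemma wcomm_in_schur0 (G : groupType) (g h : G) :
  [~ g, h] = 1 -> in_schur0 (wcomm g h).
Proof.
move=> /eqP/commgP gh; apply: generated_in; exists g^-1, h^-1; split=> //.
by apply/eqP/commgP/commuteV/commute_sym/commuteV/commute_sym.
Qed.

(** [M(G)] is contained in [M_0(G)]: modulo the image of [M_0(G)], the lifts of
    the vertices define a section of the projection to [G], whose value at
    [ext_comm w] is the class of [w]. *)
Lemma raag_schur_sub_schur0 (V : finType) (e : rel V)
  (w : ext_square (raag e)) : ext_comm w = 1 -> in_schur0 w.
Proof.
move=> w1.
have [E [t [pt ct]]] := ext_over_lift (pgen (raag_rel e)) (enum V).
have {}pt a : over_proj E (t a) = pgen (raag_rel e) a.
  by apply: pt; rewrite mem_enum.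
have {}ct a b : [~ t a, t b] =
    over_in E (wcomm (pgen (raag_rel e) a) (pgen (raag_rel e) b)).
  by apply: ct; rewrite mem_enum.
pose N := over_schur0_normal E.
pose q : UMagmaMorphism.type (ext_square (raag e)) (quotient_group N) :=
  quot_proj N \o over_in E.
have sR u v : raag_rel e u v ->
    eval_word (quot_proj N \o t) u = eval_word (quot_proj N \o t) v.
  case=> a b eab; rewrite /eval_word !big_cons big_nil /= mulg1.
  rewrite -[LHS]/[~ quot_proj N (t a), quot_proj N (t b)] -gmulfR ct.
  apply/quot_proj_eq1; eexists; last reflexivity.
  exact/wcomm_in_schur0/raag_edge_comm.
pose s := @presented_lift _ (raag_rel e) (quotient_group N) (quot_proj N \o t).
pose sM := isUMagmaMorphism.Build _ _ s (presented_lift_is_morphism sR).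
pose s' : UMagmaMorphism.type (presented (raag_rel e)) (quotient_group N) :=
  HB.pack s sM.
have s'E a : s' (pgen _ a) = quot_proj N (t a) by apply: presented_lift_gen.
have : s' (ext_comm w) = q w.
  apply: section_ext_comm => [a g h|a b]; rewrite !s'E /=.
    by rewrite -gmulfJ over_inJ pt.
  by rewrite -gmulfR ct.
rewrite w1 gmulf1 => /esym/quot_proj_eq1[w' Sw'].
by move=> /over_in_inj ->.
Qed.

Theorem corollary3p11 (V : finType) (e : rel V)
  (esym : symmetric e) (eirr : irreflexive e) :
  forall x : B0 (raag e), x = 1%g.
Proof.
move=> x; rewrite -[x]reprK; apply/quot_proj_eq1.
by apply: raag_schur_sub_schur0; apply/eqP; apply: (valP (repr x)).
Qed.
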